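(* Let $\Gamma$ be a set of consequence pairs. Then for every consequence pair $\phi\trianglelefteq\psi$: $\phi\trianglelefteq\psi\in\mathbf{CL}(\Gamma)$ if and only if every selection L-space that validates all consequence pairs in $\Gamma$ also validates $\phi\trianglelefteq\psi$.
   Context: Formulas are generated by $\phi::=p\mid\top\mid\bot\mid\phi\wedge\phi\mid\phi\vee\phi\mid\phi\Rightarrow\phi$ with $p$ from a fixed set Prop of proposition letters. A consequence pair is an expression $\phi\trianglelefteq\psi$. $\mathbf{CL}(\Gamma)$ is the smallest set of consequence pairs containing $\Gamma$, closed under uniform substitution, containing $p\trianglelefteq\top$, $\bot\trianglelefteq p$, $p\trianglelefteq p$, $p\wedge q\trianglelefteq p$, $p\wedge q\trianglelefteq q$, $p\trianglelefteq p\vee q$, $q\trianglelefteq p\vee q$, $\top\trianglelefteq p\Rightarrow\top$, $p\Rightarrow(q\wedge r)\trianglelefteq(p\Rightarrow q)\wedge(p\Rightarrow r)$, $(p\Rightarrow q)\wedge(p\Rightarrow r)\trianglelefteq p\Rightarrow(q\wedge r)$, and closed under the rules: from $p\trianglelefteq q$, $q\trianglelefteq r$ infer $p\trianglelefteq r$; from $r\trianglelefteq p$, $r\trianglelefteq q$ infer $r\trianglelefteq p\wedge q$; from $p\trianglelefteq r$, $q\trianglelefteq r$ infer $p\vee q\trianglelefteq r$; from $p\trianglelefteq q$ and $q\trianglelefteq p$ infer $p\Rightarrow r\trianglelefteq q\Rightarrow r$ and $r\Rightarrow p\trianglelefteq r\Rightarrow q$. Meet-semilattice notation: $(X,1,\curlywedge)$,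 $x\preccurlyeq y$ iff $x\curlywedge y=x$; filters are upward closed subsets closed under finite meets; $p\sqcup q:={\uparrow}\{x\curlywedge y:x\in p,y\in q\}$. An L-space is $(X,1,\curlywedge,\tau)$ with $(X,\tau)$ compact, clopen filters closed under $\sqcup$, and HMS separation ($x\not\preccurlyeq y$ implies some clopen filter contains $x$ but not $y$). A selection L-space is an L-space with a map $s$ from (points, clopen filters) to closed filters satisfying: $s(1,a)=\{1\}$; $x\preccurlyeq y\Rightarrow s(y,a)\subseteq s(x,a)$; if $z\in s(x\curlywedge y,a)$ there are $u\in s(x,a)$, $v\in s(y,a)$ with $u\curlywedge v\preccurlyeq z$; and $a\Rightarrow b:=\{x:s(x,a)\subseteq b\}$ is a clopen filter for clopen filters $a,b$. A clopen valuation $V$ assigns a clopen filter to each letter. Truth: $x\Vdash p$ iff $x\in V(p)$; $x\Vdash\top$ always; $x\Vdash\bot$ iff $x=1$; $\wedge$ pointwise; $x\Vdash\phi\vee\psi$ iff there are $y,z$ with $y\Vdash\phi$, $z\Vdash\psi$, $y\curlywedge z\preccurlyeq x$; $x\Vdash\phi\Rightarrow\psi$ iff $s(x,[\![\phi]\!])\subseteq[\![\psi]\!]$, where $[\![\phi]\!]$ is the set of points satisfying $\phi$. A selection L-space validates $\phi\trianglelefteq\psi$ if $[\![\phi]\!]\subseteq[\![\psi]\!]$ under every clopen valuation.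
   Formalization: Closure of clopen filters under ⊔ is taken to include the empty join, so {1} is required to be clopen in every L-space; otherwise s(x,[[⊥]]) and the truth of ⊥⇒φ are undefined. *)

(* Defs.v *)
From mathcomp Require Import all_boot.
From mathcomp Require Import boolp classical_sets topology.

Set Implicit Arguments.
Unset Strict Implicit.
Unset Printing Implicit Defensive.

Local Open Scope classical_set_scope.

Inductive fml (P : Type) : Type :=
  | Letter of P
  | FTop
  | FBot
  | FAnd of fml P & fml P
  | FOr of fml P & fml P
  | FImp of fml P & fml P.

Arguments FTop {P}.
Arguments FBot {P}.

Declare Scope fml_scope.
Delimit Scope fml_scope with fml.
Bind Scope fml_scope with fml.
Notation "⊤" := FTop (at level 0) : fml_scope.
Notation "⊥" := FBot (at level 0) : fml_scope.
Notation "x ∧ y" := (FAnd x y) (at level 40, left associativity) : fml_scope.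
Notation "x ∨ y" := (FOr x y) (at level 50, left associativity) : fml_scope.
Notation "x ⇒ y" := (FImp x y) (at level 55, right associativity) : fml_scope.

Record cpair (P : Type) : Type := CPair { antecedent : fml P; consequent : fml P }.

Notation "x ⊴ y" := (CPair x%fml y%fml) (at level 60, no associativity).

Fixpoint fsubst (P : Type) (σ : P -> fml P) (f : fml P) : fml P :=
  match f with
  | Letter p => σ p
  | FTop => ⊤
  | FBot => ⊥
  | FAnd f1 f2 => fsubst σ f1 ∧ fsubst σ f2
  | FOr f1 f2 => fsubst σ f1 ∨ fsubst σ f2
  | FImp f1 f2 => fsubst σ f1 ⇒ fsubst σ f2
  end%fml.

(* p, q, r range over all formulas.  For the axioms this amounts to closure
   under uniform substitution of their instances at distinct letters; it does
   not require P to have enough letters for those instances to exist. *)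
Inductive CL (P : Type) (Γ : set (cpair P)) : set (cpair P) :=
  | CL_hyp c : Γ c -> CL Γ c
  | CL_subst σ p q : CL Γ (p ⊴ q) -> CL Γ (fsubst σ p ⊴ fsubst σ q)
  | CL_top p : CL Γ (p ⊴ ⊤)
  | CL_bot p : CL Γ (⊥ ⊴ p)
  | CL_refl p : CL Γ (p ⊴ p)
  | CL_andl p q : CL Γ (p ∧ q ⊴ p)
  | CL_andr p q : CL Γ (p ∧ q ⊴ q)
  | CL_orl p q : CL Γ (p ⊴ p ∨ q)
  | CL_orr p q : CL Γ (q ⊴ p ∨ q)
  | CL_imp_top p : CL Γ (⊤ ⊴ p ⇒ ⊤)
  | CL_imp_and p q r : CL Γ (p ⇒ (q ∧ r) ⊴ (p ⇒ q) ∧ (p ⇒ r))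
  | CL_and_imp p q r : CL Γ ((p ⇒ q) ∧ (p ⇒ r) ⊴ p ⇒ (q ∧ r))
  | CL_trans p q r : CL Γ (p ⊴ q) -> CL Γ (q ⊴ r) -> CL Γ (p ⊴ r)
  | CL_and p q r : CL Γ (r ⊴ p) -> CL Γ (r ⊴ q) -> CL Γ (r ⊴ p ∧ q)
  | CL_or p q r : CL Γ (p ⊴ r) -> CL Γ (q ⊴ r) -> CL Γ (p ∨ q ⊴ r)
  | CL_congl p q r :
      CL Γ (p ⊴ q) -> CL Γ (q ⊴ p) -> CL Γ (p ⇒ r ⊴ q ⇒ r)
  | CL_congr p q r :
      CL Γ (p ⊴ q) -> CL Γ (q ⊴ p) -> CL Γ (r ⇒ p ⊴ r ⇒ q).

(* MathComp's order and topology hierarchies have no common join over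
   semilattices, so the operations are fields; ⋏ is not assumed continuous. *)
Record topSemilattice : Type := TopSemilattice {
  points :> topologicalType;
  sl_one : points;
  sl_meet : points -> points -> points;
  sl_meetA : associative sl_meet;
  sl_meetC : commutative sl_meet;
  sl_meetxx : idempotent_op sl_meet;
  sl_meet1x : left_id sl_one sl_meet
}.

Arguments sl_one {_}.

Notation "'𝟙'" := sl_one (at level 0).
Notation "x ⋏ y" := (sl_meet x y) (at level 40, left associativity).
Notation "x ≼ y" := (x ⋏ y = x) (at level 70, no associativity).

Section Filters.
Context {X : topSemilattice}.
Implicit Types (x y z : X) (a b : set X).

(* Contains the empty meet 𝟙, hence nonempty; X itself is a filter. *)
Definition semilattice_filter a : Prop :=
  [/\ a 𝟙, forall x y, a x -> a y -> a (x ⋏ y)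
    & forall x y, a x -> x ≼ y -> a y].

Definition clopen_filter a : Prop := semilattice_filter a /\ clopen a.

Definition closed_filter a : Prop := semilattice_filter a /\ closed a.

Definition filter_join a b : set X :=
  [set z | exists x y, [/\ a x, b y & x ⋏ y ≼ z]].

(* Closure under ⊔ is closure under finite joins; the empty join is the least
   filter {𝟙}.  Without it the truth set of ⊥ could fail to be clopen, and then
   the truth clause for ⊥ ⇒ φ would be undefined. *)
Record is_Lspace : Prop := IsLspace {
  Lspace_compact : compact [set: X];
  Lspace_join0 : clopen_filter [set 𝟙];
  Lspace_join : forall a b, clopen_filter a -> clopen_filter b ->
    clopen_filter (filter_join a b);
  Lspace_separation : forall x y, ~ x ≼ y ->
    exists a, [/\ clopen_filter a, a x & ~ a y]
}.

Definition simp (s : X -> set X -> set X) a b : set X := [set x | s x a `<=` b].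

(* s is total for convenience; only its values at clopen filters matter. *)
Record is_selection (s : X -> set X -> set X) : Prop := IsSelection {
  sel_closed : forall x a, clopen_filter a -> closed_filter (s x a);
  sel_one : forall a, clopen_filter a -> s 𝟙 a = [set 𝟙];
  sel_anti : forall x y a, clopen_filter a -> x ≼ y -> s y a `<=` s x a;
  sel_meet : forall x y z a, clopen_filter a -> s (x ⋏ y) a z ->
    exists u v, [/\ s x a u, s y a v & u ⋏ v ≼ z];
  sel_clopen : forall a b, clopen_filter a -> clopen_filter b ->
    clopen_filter (simp s a b)
}.

End Filters.

Arguments is_Lspace X : clear implicits.

Record selLspace : Type := SelLspace {
  carrier :> topSemilattice;
  sel : carrier -> set carrier -> set carrier;
  selLspace_Lspace : is_Lspace carrier;
  selLspace_selection : is_selection sel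
}.

Section Semantics.
Context (X : selLspace) {P : Type}.

Definition clopen_valuation (V : P -> set X) : Prop :=
  forall p, clopen_filter (V p).

Fixpoint truth_set (V : P -> set X) (f : fml P) : set X :=
  match f with
  | Letter p => V p
  | FTop => [set: X]
  | FBot => [set 𝟙]
  | FAnd f1 f2 => truth_set V f1 `&` truth_set V f2
  | FOr f1 f2 =>
      [set x | exists y z, [/\ truth_set V f1 y, truth_set V f2 z & y ⋏ z ≼ x]]
  | FImp f1 f2 => [set x | sel x (truth_set V f1) `<=` truth_set V f2]
  end.

Definition validates (c : cpair P) : Prop :=
  forall V : P -> set X, clopen_valuation V ->
    truth_set V (antecedent c) `<=` truth_set V (consequent c).

End Semantics.

(* Main.v *)
Require Import Defs.
From Stdlib Require List.
From HB Require Import structures.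
From mathcomp Require Import all_boot.
From mathcomp Require Import boolp classical_sets topology.

Set Implicit Arguments.
Unset Strict Implicit.
Unset Printing Implicit Defensive.

Local Open Scope classical_set_scope.

(** Soundness holds because truth sets are clopen filters, so that substituting
    formulas for letters amounts to changing the clopen valuation.

    For completeness, the canonical space consists of the theories, i.e. the
    filters of the Lindenbaum lattice of [CL Γ], with intersection as meet and
    the topology generated by the sets [thset a] of theories containing [a]
    and their complements.  Its clopen filters are exactly the sets [thset a]:
    a closed filter [C] contains the intersection [g] of its members, and a
    basic neighbourhood of [g] that lies in [C] also contains the principal
    theory of some formula [a] in [g], whence [C = thset a].
    Putting [s(x, thset a) := {y | b ∈ y whenever a ⇒ b ∈ x}] gives a selection
    L-space in which every clopen valuation is a substitution, so that it
    validates exactly the pairs in [CL Γ]. *)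

(** * Soundness for selection L-spaces *)

Section Soundness.
Context (P : Type) (X : selLspace).
Implicit Types (V : P -> set X) (f : fml P).

Lemma truth_set_clopen_filter V f :
  clopen_valuation V -> clopen_filter (truth_set V f).
Proof.
move=> HV; have XL := selLspace_Lspace X.
elim: f => [p|||f IHf g IHg|f IHf g IHg|f IHf g IHg] /=.
- exact: HV.
- by split; [split|exact: clopenT].
- exact: Lspace_join0 XL.
- case: IHf => [[f1 fM fU] fC]; case: IHg => [[g1 gM gU] gC].
  split; last exact: clopenI.
  split=> [//|x y [fx gx] [fy gy]|x y [fx gx] xy].
    by split; [exact: fM|exact: gM].
  by split; [exact: fU xy|exact: gU xy].
- exact: Lspace_join XL _ _ IHf IHg.
- exact: sel_clopen (selLspace_selection X) _ _ IHf IHg.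
Qed.

Lemma truth_set_subst V (σ : P -> fml P) f :
  truth_set V (fsubst σ f) = truth_set (fun p => truth_set V (σ p)) f.
Proof. by elim: f => //= f -> g ->. Qed.

Lemma CL_sound (Γ : set (cpair P)) (c : cpair P) :
  (forall d, Γ d -> validates X d) -> CL Γ c -> validates X c.
Proof.
move=> HΓ; elim=> {c} [c /HΓ //|σ p q _ IH|p|p|p|p q|p q|p q|p q|p|p q r|p q r
  |p q r _ IHpq _ IHqr|p q r _ IHp _ IHq|p q r _ IHp _ IHq
  |p q r _ IHpq _ IHqp|p q r _ IHpq _ IHqp] V HV /=;
  have tsF f := truth_set_clopen_filter f HV.
- by rewrite !truth_set_subst; apply: IH => l; exact: tsF.
- by [].
- by move=> x ->; have [[]] := tsF p.
- by [].
- by move=> x [].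
- by move=> x [].
- move=> x px; exists x, 𝟙; have [[q1 _ _] _] := tsF q; split => //.
  by rewrite (sl_meetC x) sl_meet1x sl_meetxx.
- move=> x qx; exists 𝟙, x; have [[p1 _ _] _] := tsF p; split => //.
  by rewrite sl_meet1x sl_meetxx.
- by move=> x _ y _.
- by move=> x H; split=> y /H [].
- by move=> x [H1 H2] y sy; split; [exact: H1|exact: H2].
- exact: subset_trans (IHpq V HV) (IHqr V HV).
- by move=> x rx; split; [exact: IHp|exact: IHq].
- move=> x [y [z [/(IHp V HV) ry /(IHq V HV) rz yz]]].
  by have [[_ rM rU] _] := tsF r; exact: rU (rM _ _ ry rz) yz.
(* [sel] need not be monotone in its filter argument, so the two truth sets are shown equal. *)
- have -> // : truth_set V p = truth_set V q.
  by apply/seteqP; split; [exact: IHpq|exact: IHqp].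
- by move=> x H y /H; exact: IHpq.
Qed.

End Soundness.

Lemma fsubst_Letter (P : Type) (f : fml P) : fsubst (@Letter P) f = f.
Proof. by elim: f => //= f -> g ->. Qed.

Section Derivations.
Context (P : Type) (Γ : set (cpair P)).
Implicit Types a b c : fml P.

(** The rules give only congruence, but [b] is equivalent to [b ∧ c] when [b ⊴ c], and [⇒]
    distributes over this conjunction. *)
Lemma CL_imp_mono a b c : CL Γ (b ⊴ c) -> CL Γ (a ⇒ b ⊴ a ⇒ c).
Proof.
move=> bc; apply: CL_trans (CL_andr Γ (a ⇒ b)%fml (a ⇒ c)%fml).
apply: CL_trans (CL_imp_and Γ a b c); apply: CL_congr.
  by apply: CL_and => //; exact: CL_refl.
exact: CL_andl.
Qed.

End Derivations.

(** * The semilattice of theories *)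

Section Theories.
Context (P : Type) (Γ : set (cpair P)).
Implicit Types (a b c : fml P) (bs : seq (fml P)).

Record theory : Type := Theory {
  theory_set :> fml P -> Prop;
  theory_top : theory_set ⊤%fml;
  theory_and a b : theory_set a -> theory_set b -> theory_set (a ∧ b)%fml;
  theory_le a b : CL Γ (a ⊴ b) -> theory_set a -> theory_set b
}.
Implicit Types x y z : theory.

HB.instance Definition _ := gen_eqMixin theory.
HB.instance Definition _ := gen_choiceMixin theory.

Lemma theory_eq x y : (forall a, x a <-> y a) -> x = y.
Proof.
case: x => x x1 x2 x3; case: y => y y1 y2 y3 /= xy.
have Exy : x = y by apply/seteqP; split=> a /xy.
by subst y; congr Theory; exact: Prop_irrelevance.
Qed.

Lemma theory_andE x a b : x (a ∧ b)%fml <-> x a /\ x b.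
Proof.
split=> [xab|[]]; last exact: theory_and.
by split; apply: theory_le xab; [exact: CL_andl|exact: CL_andr].
Qed.

Program Definition principal a : theory := @Theory (fun b => CL Γ (a ⊴ b)) _ _ _.
Next Obligation. by move=> a; exact: CL_top. Qed.
Next Obligation. by move=> a b c; exact: CL_and. Qed.
Next Obligation. by move=> a b c bc ab; exact: CL_trans ab bc. Qed.

(** The improper theory is the unit for intersection and the only theory containing [⊥]. *)
Program Definition theoryT : theory := @Theory setT _ _ _.
Solve Obligations with by [].

Program Definition theoryI x y : theory := @Theory (theory_set x `&` theory_set y) _ _ _.
Next Obligation. by move=> x y; split; exact: theory_top. Qed.
Next Obligation.
by move=> x y a b [xa ya] [xb yb]; split; exact: theory_and.
Qed.
Next Obligation.
by move=> x y a b ab [xa ya]; split; [exact: theory_le xa|exact: theory_le ya].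
Qed.

(** This will be the least point selected at [x] and [thset a]. *)
Program Definition conditional x a : theory :=
  @Theory (fun b => x (a ⇒ b)%fml) _ _ _.
Next Obligation.
by move=> x a; apply: theory_le (CL_imp_top Γ a) (theory_top x).
Qed.
Next Obligation.
move=> x a b c xb xc; apply: theory_le (CL_and_imp Γ a b c) _.
exact: theory_and.
Qed.
Next Obligation. by move=> x a b c bc; apply: theory_le; exact: CL_imp_mono. Qed.

Definition thset a : set theory := [set x : theory | x a].

Lemma thset_sub a b : thset a `<=` thset b -> CL Γ (a ⊴ b).
Proof. by move/(_ (principal a)); apply; exact: CL_refl. Qed.

(** * Topology and compactness *)

Definition avoids x bs := List.Forall (fun b => ~ x b) bs.

(** Conjunction merges positive conditions into one formula. Negative ones need a list: theories
    need not be prime, so one may avoid [b] and [c] yet contain [b ∨ c]. *)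
Definition basic a bs : set theory := [set x : theory | x a /\ avoids x bs].

Definition theory_open (U : set theory) : Prop :=
  forall x, U x -> exists a bs, basic a bs x /\ basic a bs `<=` U.

Lemma theory_openT : theory_open setT.
Proof.
move=> x _; exists ⊤%fml, [::]; split=> //; split; first exact: theory_top.
exact: List.Forall_nil.
Qed.

Lemma theory_openI : setI_closed theory_open.
Proof.
move=> U V oU oV x [/oU [a [bs [[xa xbs] sU]]] /oV [c [ds [[xc xds] sV]]]].
exists (a ∧ c)%fml, (bs ++ ds); split.
  by split; [exact: theory_and|apply/List.Forall_app].
move=> y [/theory_andE [ya yc] /List.Forall_app [ybs yds]].
by split; [exact: sU|exact: sV].
Qed.

Lemma theory_open_bigU (I : Type) (U : I -> set theory) :
  (forall i, theory_open (U i)) -> theory_open (\bigcup_i U i).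
Proof.
move=> oU x [i _ /oU [a [bs [xab sU]]]]; exists a, bs; split=> //.
by move=> y /sU; exists i.
Qed.

HB.instance Definition _ :=
  isOpenTopological.Build theory theory_openT theory_openI theory_open_bigU.

Lemma theory_openE (U : set theory) : open U = theory_open U.
Proof. by []. Qed.

Lemma thset_clopen a : clopen (thset a).
Proof.
split; first rewrite theory_openE => x xa.
  by exists a, [::]; split; [split=> //; exact: List.Forall_nil|move=> y []].
rewrite -openC theory_openE => x nxa; exists ⊤%fml, [:: a]; split.
  by split; [exact: theory_top|apply: List.Forall_cons].
by move=> y [_ ya]; exact: List.Forall_inv ya.
Qed.

Lemma theory_compact : compact [set: theory].
Proof.
rewrite compact_ultra => F UF _.
have Fle a b : CL Γ (a ⊴ b) -> F (thset a) -> F (thset b).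
  by move=> ab; apply: filterS => x; exact: theory_le.
have F1 : F (thset ⊤%fml).
  by apply: filterS (@filterT _ F _) => x _; exact: theory_top.
have FI a b : F (thset a) -> F (thset b) -> F (thset (a ∧ b)%fml).
  by move=> Fa Fb; apply: filterS (filterI Fa Fb) => x [] ; exact: theory_and.
(* The limit of the ultrafilter [F]: if [b] is not in [g], then [F] contains the complement of
   [thset b]. *)
pose g := @Theory (fun a => F (thset a)) F1 FI Fle.
exists g; split=> // A [U [oU Ug sUA]]; apply: filterS sUA _.
have [a [bs [[ga gbs] sU]]] := oU g Ug; apply: filterS sU _.
apply: filterI => //; elim: gbs => [|b {}bs gb _ IH].
  by apply: filterS filterT => x _; exact: List.Forall_nil.
have [//|Fnb] := in_ultra_setVsetC (thset b) UF.
by apply: filterS (filterI Fnb IH) => x [xb xbs]; exact: List.Forall_cons.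
Qed.

Lemma theoryIA : associative theoryI.
Proof. by move=> x y z; apply: theory_eq => a; rewrite /= /setI /=; tauto. Qed.

Lemma theoryIC : commutative theoryI.
Proof. by move=> x y; apply: theory_eq => a; rewrite /= /setI /=; tauto. Qed.

Lemma theoryIxx : idempotent_op theoryI.
Proof. by move=> x; apply: theory_eq => a; rewrite /= /setI /=; tauto. Qed.

Lemma theoryITx : left_id theoryT theoryI.
Proof. by move=> x; apply: theory_eq => a; rewrite /= /setI /=; tauto. Qed.

Definition theory_semilattice : topSemilattice :=
  @TopSemilattice theory theoryT theoryI theoryIA theoryIC theoryIxx theoryITx.

Local Notation T := theory_semilattice.

Lemma theory_leE (x y : T) :
  x ≼ y <-> theory_set x `<=` theory_set y.
Proof.
split=> [xy a xa|xy]; first by move: xa; rewrite -xy => -[].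
by apply: theory_eq => a; split=> [[]|xa] //; split=> //; exact: xy.
Qed.

(** * Clopen filters and formulas *)

Lemma thset_clopen_filter a : @clopen_filter T (thset a).
Proof.
split; last exact: thset_clopen.
by split=> [//|x y xa ya|x y xa /theory_leE]; [split|exact].
Qed.

(** The finite meet of the given witnesses lies in [C] and omits every formula of the list. *)
Lemma filter_avoids (C : set T) bs : semilattice_filter C ->
  List.Forall (fun b => exists2 x : T, C x & ~ x b) bs ->
  exists2 x : T, C x & avoids x bs.
Proof.
move=> [C1 CM _]; elim=> [|b {}bs [x Cx xb] _ [y Cy ybs]].
  by exists 𝟙 => //; exact: List.Forall_nil.
exists (x ⋏ y); first exact: CM.
apply: List.Forall_cons; first by case.
by apply: List.Forall_impl ybs => c nyc [].
Qed.

Lemma clopen_filter_thset (C : set T) :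
  clopen_filter C -> exists a, C = thset a.
Proof.
move=> [fC [oC]]; rewrite -openC => oCC; have [C1 CM CU] := fC.
pose g : theory := @Theory (fun a => C `<=` thset a)
  (fun x _ => theory_top x)
  (fun a b Ha Hb x Cx => theory_and (Ha x Cx) (Hb x Cx))
  (fun a b ab Ha x Cx => theory_le ab (Ha x Cx)).
have Cg : C g.
  (* Otherwise a basic neighbourhood of [g] misses [C]; but each [b] outside [g] is omitted by some
     point of [C], so [filter_avoids] yields a point in both. *)
  apply: contrapT => /oCC [a [bs [[ga gbs] sCC]]].
  have [] := filter_avoids fC (bs := bs).
    apply: List.Forall_impl gbs => b nb; apply: contrapT => H.
    by apply: nb => x Cx; apply: contrapT => xb; apply: H; exists x.
  by move=> x Cx xbs; apply: (sCC x) => //; split=> //; exact: ga.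
have [a [bs [[ga gbs] sC]]] := oC g Cg.
exists a; apply/seteqP; split=> [x Cx|x xa]; first exact: ga.
have Ca : C (principal a).
  apply: sC; split; first exact: CL_refl.
  (* A consequence of [a] already lies in [g], so [principal a] avoids whatever [g] avoids. *)
  by apply: List.Forall_impl gbs => b nb ab; apply: nb; exact: theory_le ab ga.
by apply: CU Ca _; apply/theory_leE => b /theory_le; apply.
Qed.

Lemma thset_or a b :
  @filter_join T (thset a) (thset b) = thset (a ∨ b)%fml.
Proof.
apply/seteqP; split=> [z [x [y [xa yb /theory_leE]]]|z zab].
  by apply; split; [exact: theory_le (CL_orl _ _ _) xa|
    exact: theory_le (CL_orr _ _ _) yb].
exists (principal a), (principal b); split; [exact: CL_refl|exact: CL_refl|].
by apply/theory_leE => c [ac bc]; apply: theory_le zab; exact: CL_or.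
Qed.

Lemma thset_bot : thset ⊥%fml = [set 𝟙 : T].
Proof.
apply/seteqP; split=> [x xbot|x ->] //.
by apply: theory_eq => a; split=> // _; exact: theory_le (CL_bot _ a) xbot.
Qed.

Lemma theory_Lspace : is_Lspace T.
Proof.
split; first exact: theory_compact.
- by rewrite -thset_bot; exact: thset_clopen_filter.
- move=> _ _ /clopen_filter_thset [a ->] /clopen_filter_thset [b ->].
  by rewrite thset_or; exact: thset_clopen_filter.
- move=> x y /theory_leE /existsNP [a /not_implyP [xa nya]].
  by exists (thset a); split=> //; exact: thset_clopen_filter.
Qed.

(** * The selection function *)

(* The quantification over all [a] with [C = thset a] makes the value
   independent of the choice of a formula representing [C]. *)
Definition theory_sel (x : T) (C : set T) : set T :=
  [set y | forall a, C = thset a -> theory_set (conditional x a) `<=` theory_set y].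

(** Formulas with the same [thset] are interderivable, so [CL_congl] identifies their
    conditionals. *)
Lemma theory_sel_thset (x : T) a :
  theory_sel x (thset a) =
  [set y | theory_set (conditional x a) `<=` theory_set y].
Proof.
apply/seteqP; split=> y /= Hy; first exact: Hy.
move=> c ac b /= xcb; apply: Hy => /=; apply: theory_le xcb.
by apply: CL_congl; apply: thset_sub; rewrite ac.
Qed.

Lemma theory_sel_imp a b :
  simp theory_sel (thset a) (thset b) = thset (a ⇒ b)%fml.
Proof.
apply/seteqP; split=> x; rewrite /simp /= theory_sel_thset.
  by move/(_ (conditional x a)); apply.
by move=> xab y; apply.
Qed.

Lemma theory_sel_closed (x : T) a :
  closed_filter (theory_sel x (thset a)).
Proof.
rewrite theory_sel_thset; split.
  split=> [//|y z xy xz b xb|y z xy /theory_leE yz]; last exact: subset_trans yz.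
  by split; [exact: xy|exact: xz].
rewrite (_ : mkset _ = \bigcap_(b in theory_set (conditional x a)) thset b); last first.
  by apply/seteqP; split.
by apply: closed_bigI => b _; have [] := thset_clopen b.
Qed.

Lemma theory_selection : is_selection theory_sel.
Proof.
split.
- by move=> x _ /clopen_filter_thset [a ->]; exact: theory_sel_closed.
- move=> _ /clopen_filter_thset [a ->]; rewrite theory_sel_thset -thset_bot.
  apply/seteqP; split=> y /= Hy; first exact: Hy.
  by move=> b _; exact: theory_le (CL_bot _ b) Hy.
- move=> x y _ /clopen_filter_thset [a ->] /theory_leE xy.
  by rewrite !theory_sel_thset => z yz b xb; apply: yz; exact: xy.
- move=> x y z _ /clopen_filter_thset [a ->]; rewrite !theory_sel_thset => xyz.
  (* The intersection of these least points is the conditional of [x ⋏ y]. *)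
  exists (conditional x a), (conditional y a).
  by split=> //; apply/theory_leE => b [xb yb]; exact: xyz.
- move=> _ _ /clopen_filter_thset [a ->] /clopen_filter_thset [b ->].
  by rewrite theory_sel_imp; exact: thset_clopen_filter.
Qed.

(** * Truth in the canonical space *)

Definition canonical_space : selLspace :=
  @SelLspace T theory_sel theory_Lspace theory_selection.

Lemma canonical_truth_set (σ : P -> fml P) (f : fml P) :
  @truth_set canonical_space P (fun p => thset (σ p)) f = thset (fsubst σ f).
Proof.
elim: f => [p|||f IHf g IHg|f IHf g IHg|f IHf g IHg] //=.
- by apply/seteqP; split=> x // _; exact: theory_top.
- by rewrite thset_bot.
- by rewrite IHf IHg; apply/seteqP; split=> x /theory_andE.
- by rewrite IHf IHg -thset_or.
- by rewrite IHf IHg -theory_sel_imp.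
Qed.

Lemma canonical_validates (f g : fml P) :
  validates canonical_space (f ⊴ g) <-> CL Γ (f ⊴ g).
Proof.
split=> [H|fg V HV].
  (* The identity substitution gives the valuation that refutes underivable pairs. *)
  have := H (fun p => thset (Letter p)) (fun p => thset_clopen_filter _).
  by rewrite /= !canonical_truth_set !fsubst_Letter; exact: thset_sub.
have /choice [σ Vσ] : forall p, exists a, V p = thset a.
  by move=> p; exact: clopen_filter_thset (HV p).
have -> : V = (fun p => thset (σ p)) by apply/funext.
by rewrite /= !canonical_truth_set => x; apply: theory_le; exact: CL_subst.
Qed.

End Theories.

Theorem theorem4p9 (P : Type) (Γ : set (cpair P)) (φ ψ : fml P) :
  CL Γ (φ ⊴ ψ) <->
  (forall X : selLspace,
     (forall c : cpair P, Γ c -> validates X c) -> validates X (φ ⊴ ψ)).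
Proof.
split=> [φψ X HΓ|H]; first exact: CL_sound HΓ φψ.
apply/canonical_validates; apply: H => -[f g] Γfg.
by apply/canonical_validates; exact: CL_hyp.
Qed.
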